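(* Let $\xi=(\xi_1,\dots,\xi_l)$ be a strict partition of $n$ and $\lambda$ a partition of $n$. Then $$b_{\xi\lambda}=\sum_{i=1}^{l}2(-1)^{i-1}\sum_{\rho^i}b_{\xi^{\hat i}\rho^i},$$ where for each $i$, $\rho^i$ runs over the partitions such that $\lambda^{[1]}/\rho^i$ is a vertical $(\xi_i-\lambda_1)$-strip.
   Context: For a strict partition $\xi$, $Q_\xi(x)$ is Schur's $Q$-function and $b_{\xi\lambda}$ are defined by $Q_\xi(x)=\sum_\lambda b_{\xi\lambda}s_\lambda(x)$ with $s_\lambda$ the Schur functions; $b_{\emptyset\emptyset}=1$. Notation: $\lambda^{[1]}=(\lambda_2,\lambda_3,\dots)$; $\xi^{\hat i}=(\xi_1,\dots,\xi_{i-1},\xi_{i+1},\dots,\xi_l)$. A vertical $s$-strip $\lambda^{[1]}/\rho$ is a skew shape with $\rho\subseteq\lambda^{[1]}$, $|\lambda^{[1]}|-|\rho|=s$ and at most one box in each row (none exists if $s<0$). *)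

(* Defs.v *)
From mathcomp Require Import all_boot all_order all_fingroup all_algebra.
From mathcomp Require Import mpoly.

Set Implicit Arguments.
Unset Strict Implicit.
Unset Printing Implicit Defensive.

Import GRing.Theory.
Local Open Scope ring_scope.

Definition is_partition (s : seq nat) : bool := sorted geq s && (0%N \notin s).

Definition is_strict_partition (s : seq nat) : bool :=
  sorted gtn s && (0%N \notin s).

(* A partition of size at most n has at most n parts, all of them at most n. *)
Definition partitions_upto (n : nat) : seq (seq nat) :=
  [seq s <- [seq map val (t : seq 'I_n.+1) | t : n.-bseq 'I_n.+1]
  | is_partition s & (sumn s <= n)%N].

Lemma uniq_partitions_upto (n : nat) : uniq (partitions_upto n).
Proof.
rewrite filter_uniq // map_inj_uniq ?enum_uniq // => t u.
by move=> /(inj_map val_inj) /val_inj.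
Qed.

Lemma mem_partitions_upto (n : nat) (s : seq nat) :
  (s \in partitions_upto n) = is_partition s && (sumn s <= n)%N.
Proof.
rewrite mem_filter; case: (boolP (is_partition s && _)) => //=.
case/andP=> /andP[_ s0] sn; apply/mapP.
have les : all (leq^~ n) s.
  apply/allP=> a a_s; apply: leq_trans sn.
  by rewrite (perm_sumn (perm_to_rem a_s)) leq_addr.
have szs : (size s <= n)%N.
  apply: leq_trans sn; elim: s s0 {les} => //= a s IHs.
  rewrite inE negb_or eq_sym -lt0n => /andP[a_gt0 s0].
  by rewrite -add1n leq_add // IHs.
have szt : (size (map (@inord n) s) <= n)%N by rewrite size_map.
exists (Bseq szt); first by rewrite mem_enum.
rewrite /= -map_comp -[LHS]map_id; apply/eq_in_map => a a_s /=.
by rewrite inordK // ltnS (allP les).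
Qed.

(* mu/rho is a vertical s-strip; s is an integer, and there is none if s < 0. *)
Definition vertical_strip (mu rho : seq nat) (s : int) : bool :=
  [&& is_partition rho,
      (size rho <= size mu)%N,
      [forall i : 'I_(size mu),
         (nth 0%N rho i <= nth 0%N mu i <= (nth 0%N rho i).+1)%N]
    & (sumn mu)%:Z - (sumn rho)%:Z == s].

Definition omit (i : nat) (s : seq nat) : seq nat := take i s ++ drop i.+1 s.

(* Symmetric functions are handled through their specialisations to N
   variables x_0, ..., x_(N-1), for all N; these are computed in the field of
   rational functions in the x_i. *)
Definition ratfun (N : nat) : fieldType := {fraction {mpoly int[N]}}.

Definition rvar (N : nat) (i : 'I_N) : ratfun N := tofrac ('X_i : {mpoly int[N]}).

(* Ratio of alternants det (x_i^(la_j + N - j)) / det (x_i^(N - j)), the rows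
   and columns being numbered from 0 here. *)
Definition schur (la : seq nat) (N : nat) : ratfun N :=
  if (size la <= N)%N then
    \det (\matrix_(i < N, j < N) rvar i ^+ (nth 0%N la j + (N - j.+1))) /
    \det (\matrix_(i < N, j < N) rvar i ^+ (N - j.+1))
  else 0.

(* The Hall-Littlewood function Q_xi(x; t) at t = -1:
     2^l sum_{w in S_N / S_(N-l)}
       w (x^xi prod_{i <= l} prod_{i < j <= N} (x_i + x_j) / (x_i - x_j)),
   with l the length of xi.  The summand is invariant under the permutations
   of the last N - l variables, so the sum over cosets is the sum over S_N
   divided by (N - l)!. *)
Definition schurQ (xi : seq nat) (N : nat) : ratfun N :=
  if (size xi <= N)%N then
    2 ^+ size xi / ((N - size xi)`!)%:R *
    \sum_(w : 'S_N) \prod_(i < N | (i < size xi)%N)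
      (rvar (w i) ^+ nth 0%N xi i *
       \prod_(j < N | (i < j)%N)
         ((rvar (w i) + rvar (w j)) / (rvar (w i) - rvar (w j))))
  else 0.

(* b xi la is the coefficient of s_la in Q_xi.  Q_xi is homogeneous of degree
   |xi| and the s_la form a basis, so this determines b xi la for every strict
   partition xi and every partition la of |xi|. *)
Definition schurQ_coefficients (b : seq nat -> seq nat -> int) : Prop :=
  forall xi : seq nat, is_strict_partition xi ->
  forall N : nat,
    schurQ xi N =
    \sum_(la <- partitions_upto (sumn xi) | sumn la == sumn xi)
      (b xi la)%:~R * schur la N.

(* Main.v *)
Require Import Defs.
From mathcomp Require Import all_boot all_order all_algebra.
From mathcomp Require Import all_fingroup.
From mathcomp Require Import mpoly.

Set Implicit Arguments.
Unset Strict Implicit.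
Unset Printing Implicit Defensive.

Import GRing.Theory.
Local Open Scope ring_scope.

(* Single out one variable x_0 in Q_xi times the Vandermonde determinant, and
   read off the coefficient of x_0^(la_1 + N - 1).  In the defining sum over
   permutations, x_0 either carries a part xi_i or none.  In the first case the
   factors containing x_0 multiply to
     2 (-1)^(i-1) x_0^(xi_i) prod_(j > 0) (x_0 + x_j),
   the rest being the same expression for xi without xi_i in the other
   variables.  In the second case the degree in x_0 is at most N - 1, so
   nothing is contributed, as la_1 > 0.  The wanted coefficient is therefore
   the sum of the 2 (-1)^(i-1) e_(xi_i - la_1) Q_(xi without xi_i), which the
   Pieri rule expands over vertical strips. *)

(** * Alternants and the numerator of [Q_xi] over an arbitrary commutative ring *)

Definition alternant (S : comNzRingType) (N : nat) (x : 'I_N -> S)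
    (la : seq nat) : S :=
  \det (\matrix_(i < N, j < N) x i ^+ (nth 0%N la j + (N - j.+1))).

(* schurQ times the Vandermonde determinant and (N - l)! / 2^l, l = size xi: here
   the denominators of schurQ cancel, the sign coming from the antisymmetry of
   the determinant. *)
Definition alternantQ (S : comNzRingType) (N : nat) (x : 'I_N -> S)
    (xi : seq nat) : S :=
  \sum_(w : 'S_N) (-1) ^+ w *
    \prod_(i < N) (x (w i) ^+ nth 0%N xi i *
      \prod_(j < N | (i < j)%N)
        (if (i < size xi)%N then x (w i) + x (w j) else x (w i) - x (w j))).

Lemma eq_alternant (S : comNzRingType) (N : nat) (x y : 'I_N -> S)
    (la : seq nat) : x =1 y -> alternant x la = alternant y la.
Proof.
by move=> xy; congr (\det _); apply/matrixP=> i j; rewrite !mxE xy.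
Qed.

Lemma eq_alternantQ (S : comNzRingType) (N : nat) (x y : 'I_N -> S)
    (xi : seq nat) : x =1 y -> alternantQ x xi = alternantQ y xi.
Proof.
move=> xy; apply: eq_bigr => w _; congr (_ * _); apply: eq_bigr => i _.
by rewrite xy; congr (_ * _); apply: eq_bigr => j _; rewrite xy.
Qed.

Lemma rmorph_alternant (S T : comNzRingType) (f : {rmorphism S -> T})
    (N : nat) (x : 'I_N -> S) (la : seq nat) :
  f (alternant x la) = alternant (f \o x) la.
Proof.
rewrite /alternant -det_map_mx; congr (\det _).
by apply/matrixP=> i j; rewrite !mxE rmorphXn.
Qed.

Lemma rmorph_alternantQ (S T : comNzRingType) (f : {rmorphism S -> T})
    (N : nat) (x : 'I_N -> S) (xi : seq nat) :
  f (alternantQ x xi) = alternantQ (f \o x) xi.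
Proof.
rewrite rmorph_sum; apply: eq_bigr => w _.
rewrite rmorphM rmorph_sign rmorph_prod; congr (_ * _).
apply: eq_bigr => i _; rewrite rmorphM rmorphXn rmorph_prod; congr (_ * _).
by apply: eq_bigr => j _ /=; case: (i < size xi)%N; rewrite ?rmorphB ?rmorphD.
Qed.

(** Up to transposition this is a Vandermonde matrix in the reversed variables with both rows and
    columns reversed; the two reversal signs cancel. *)
Lemma alternant_nil (S : comNzRingType) (N : nat) (x : 'I_N -> S) :
  alternant x [::] = \prod_(i < N) \prod_(j < N | (i < j)%N) (x i - x j).
Proof.
pose r : 'S_N := perm (@rev_ord_inj N); pose y := \row_j x (rev_ord j).
have -> : alternant x [::] = \det (row_perm r (col_perm r (Vandermonde N y))).
  rewrite /alternant -det_tr; congr (\det _); apply/matrixP=> i j.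
  by rewrite !mxE !permE rev_ordK nth_nil add0n.
rewrite row_permE col_permE !det_mulmx !det_perm odd_permV.
rewrite mulrCA -signr_addb addbb mulr1 det_Vandermonde.
rewrite (exchange_big_dep xpredT) //= (reindex_inj rev_ord_inj) /=; apply: eq_bigr => i _.
rewrite (reindex_inj rev_ord_inj) /=; apply: eq_big => [j|j _].
  by rewrite ltn_sub2lE // ltnS.
by rewrite !mxE !rev_ordK.
Qed.

Lemma alternant_perm (S : comNzRingType) (N : nat) (x : 'I_N -> S) (w : 'S_N)
    (la : seq nat) :
  alternant (x \o w) la = (-1) ^+ w * alternant x la.
Proof.
rewrite /alternant -det_perm -det_mulmx -row_permE; congr (\det _).
by apply/matrixP=> i j; rewrite !mxE.
Qed.

(** * Clearing denominators and transferring the Schur expansion *)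

Lemma rvar_inj (N : nat) : injective (@rvar N).
Proof.
move=> i j /eqP; rewrite tofrac_eq => /eqP /(congr1 (mcoeff U_(j))).
by rewrite !mcoeffXU eqxx; case: eqP.
Qed.

Lemma alternant_rvar_neq0 (N : nat) : alternant (@rvar N) [::] != 0.
Proof.
rewrite alternant_nil; apply/prodf_neq0 => i _; apply/prodf_neq0 => j ij.
by rewrite subr_eq0 (inj_eq (@rvar_inj N)); apply: contraTneq ij => ->; rewrite ltnn.
Qed.

Lemma natr_ratfun_eq0 (N k : nat) : (k%:R == 0 :> ratfun N) = (k == 0)%N.
Proof.
rewrite -[k%:R](rmorph_nat (@tofrac {mpoly int[N]})) tofrac_eq0.
apply/eqP/eqP => [/(congr1 (mcoeff 0%MM)) /eqP | -> //].
by rewrite mcoeff0 mcoeffMn mcoeff1 eqxx -[_ *+ _]/(k%:R) Num.Theory.pnatr_eq0 => /eqP.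
Qed.

Lemma schurQ_alternantQ (xi : seq nat) (N : nat) : (size xi <= N)%N ->
  schurQ xi N * alternant (@rvar N) [::] * ((N - size xi)`!)%:R =
  2 ^+ size xi * alternantQ (@rvar N) xi.
Proof.
move=> le_xi_N; rewrite /schurQ le_xi_N.
have fact_neq0 : ((N - size xi)`!)%:R != 0 :> ratfun N.
  by rewrite natr_ratfun_eq0 -lt0n fact_gt0.
rewrite mulrAC [_ / _ * _ * _]mulrAC divfK // -mulrA; congr (_ * _).
rewrite mulr_suml; apply: eq_bigr => w _.
(* For each [w] the Vandermonde product is rewritten in the permuted variables, so that its factors
   match the denominators of that summand. *)
have -> : alternant (@rvar N) [::] = (-1) ^+ w * alternant (@rvar N \o w) [::].
  by rewrite alternant_perm mulrA -signr_addb addbb mul1r.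
rewrite mulrCA alternant_nil big_mkcond -big_split; congr (_ * _).
apply: eq_bigr => i _ /=; case: ltnP => [_|le_i]; last first.
  by rewrite nth_default // expr0 !mul1r.
rewrite -mulrA -big_split; congr (_ * _); apply: eq_bigr => j ij /=.
apply: divfK; rewrite subr_eq0 (inj_eq (@rvar_inj N)) (inj_eq perm_inj).
by apply: contraTneq ij => ->; rewrite ltnn.
Qed.

Lemma size_partition (s : seq nat) : is_partition s -> (size s <= sumn s)%N.
Proof.
case/andP=> _; elim: s => //= a s IHs.
rewrite inE negb_or eq_sym -lt0n => /andP[a_gt0 s0].
by rewrite -add1n leq_add // IHs.
Qed.

Lemma strict_partition (s : seq nat) : is_strict_partition s -> is_partition s.
Proof.
case/andP=> s_dec s0; rewrite /is_partition s0 andbT.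
by apply: sub_sorted s_dec => i j /ltnW.
Qed.

Lemma alternantQ_expansion (b : seq nat -> seq nat -> int)
    (b_coef : schurQ_coefficients b) (S : comNzRingType) (N : nat)
    (x : 'I_N -> S) (xi : seq nat) :
  is_strict_partition xi -> (sumn xi <= N)%N ->
  2 ^+ size xi * alternantQ x xi =
  ((N - size xi)`!)%:R *
    \sum_(la <- partitions_upto (sumn xi) | sumn la == sumn xi)
      (b xi la)%:~R * alternant x la.
Proof.
move=> xi_strict le_xi_N.
have le_size : (size xi <= N)%N.
  exact: leq_trans (size_partition (strict_partition xi_strict)) le_xi_N.
(* The generic case over the integers suffices: [mmap] carries it to any [S], and injectivity of
   [tofrac] lets it be checked in the field of rational functions. *)
suff EX : 2 ^+ size xi * alternantQ (fun i => 'X_i : {mpoly int[N]}) xi =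
    ((N - size xi)`!)%:R *
    \sum_(la <- partitions_upto (sumn xi) | sumn la == sumn xi)
      (b xi la)%:~R * alternant (fun i => 'X_i : {mpoly int[N]}) la.
  pose phi : {rmorphism {mpoly int[N]} -> S} := mmap intr x.
  have phiX la : phi (alternant (fun i => 'X_i) la) = alternant x la.
    by rewrite rmorph_alternant; apply: eq_alternant => i /=; rewrite mmapX mmap1U.
  move/(congr1 phi): EX.
  rewrite !rmorphM /= rmorphXn rmorph_nat rmorph_nat rmorph_alternantQ rmorph_sum.
  rewrite (eq_alternantQ (y := x)) => [EX|i]; last by rewrite /= mmapX mmap1U.
  rewrite EX; congr (_ * _); apply: eq_bigr => la _.
  by rewrite rmorphM rmorph_int phiX.
apply/eqP; rewrite -tofrac_eq; apply/eqP.
rewrite !rmorphM /= rmorphXn rmorph_nat rmorph_nat rmorph_alternantQ rmorph_sum.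
rewrite -(schurQ_alternantQ le_size) (b_coef _ xi_strict) [LHS]mulrC.
congr (_ * _); rewrite mulr_suml big_seq_cond [RHS]big_seq_cond.
apply: eq_bigr => la; rewrite mem_partitions_upto => /andP[/andP[la_part _] /eqP la_xi].
rewrite rmorphM rmorph_int rmorph_alternant -mulrA; congr (_ * _).
(* This puts [schur] in the case of the quotient of determinants, not of the default 0. *)
have le_la : (size la <= N)%N.
  by apply: leq_trans (size_partition la_part) _; rewrite la_xi.
rewrite /schur le_la; have := alternant_rvar_neq0 N; rewrite /alternant.
set D := \det _ => D0; set E := \det _; set F := \det _.
have -> : F = D by congr (\det _); apply/matrixP=> i j; rewrite !mxE nth_nil add0n.
by rewrite divfK.
Qed.

(** * Splitting permutations by the position of the first variable *)

Lemma lift_perm0_bij (M : nat) :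
  bijective (fun u : 'I_M.+1 * 'S_M => lift_perm u.1 ord0 u.2).
Proof.
apply: inj_card_bij; last by rewrite card_prod card_ord !card_Sn factS.
move=> [p w] [q v] /= E.
have pq : p = q.
  (* The index [p] is recovered from the permutation as the preimage of [ord0]. *)
  apply/eqP; apply/negPn/negP => /eqP neq_pq; have := congr1 (fun s : 'S__ => s p) E.
  rewrite lift_perm_id; case: (unliftP q p) => [k ->|//].
  by rewrite lift_perm_lift => /eqP; rewrite (negPf (neq_lift _ _)).
rewrite {}pq in E *; congr (_, _); apply/permP=> k; apply: (@lift_inj _ ord0).
by rewrite -!(lift_perm_lift q) E.
Qed.


Lemma nth_omit (p : nat) (s : seq nat) (k : nat) : (p < size s)%N ->
  nth 0%N (omit p s) k = nth 0%N s (bump p k).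
Proof.
move=> lt_ps; rewrite /omit nth_cat size_take lt_ps /bump.
case: ltnP => [lt_kp|le_pk]; first by rewrite nth_take.
by rewrite nth_drop addSn subnKC.
Qed.

Lemma size_omit (p : nat) (s : seq nat) : (p < size s)%N ->
  size (omit p s) = (size s).-1.
Proof.
move=> lt_ps; rewrite /omit size_cat size_take lt_ps size_drop.
by rewrite -[in RHS](subnKC lt_ps).
Qed.

(* The permutations are grouped by the position p of [x ord0]. *)
Lemma alternantQ_lift_perm (S : comNzRingType) (M : nat) (x : 'I_M.+1 -> S)
    (xi : seq nat) (y := fun k => x (lift ord0 k))
    (G := fun (i : nat) (a c : S) => if (i < size xi)%N then a + c else a - c) :
  alternantQ x xi =
  \sum_(p < M.+1) (-1) ^+ p * \sum_(v : 'S_M) (-1) ^+ v *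
    (x ord0 ^+ nth 0%N xi p *
     \prod_(k < M) (if (p <= k)%N then G p (x ord0) (y (v k))
                    else G k (y (v k)) (x ord0)) *
     \prod_(k < M) (y (v k) ^+ nth 0%N xi (bump p k) *
       \prod_(j < M | (k < j)%N) G (bump p k) (y (v k)) (y (v j)))).
Proof.
rewrite /alternantQ (reindex _ (onW_bij _ (lift_perm0_bij M))).
rewrite (eq_bigr _ (fun p _ => big_distrr _ _ _)) pair_bigA /=.
apply: eq_bigr => -[p v] _ /=.
rewrite odd_lift_perm /= addbF signr_addb signr_odd -mulrA; congr (_ * (_ * _)).
rewrite (bigD1_ord p) //= lift_perm_id -!mulrA; congr (_ * _).
rewrite [X in X * _ = _]big_mkcond (bigD1_ord p) //= ltnn mul1r -!big_split /=.
apply: eq_bigr => k _; rewrite lift_perm_lift.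
rewrite [X in _ * (_ * X) = _]big_mkcond (bigD1_ord p) //= lift_perm_id.
(* With position [p] deleted, [bump p k] is the original position of the [k]-th remaining one; it
   precedes [p] exactly when [k < p]. *)
rewrite (_ : (bump p k < p)%N = ~~ (p <= k)%N); last first.
  by rewrite ltnNge leq_bump /unbump ltnn subn0.
rewrite (_ : (p < bump p k)%N = (p <= k)%N); last first.
  by rewrite leq_bump /unbump ltnSn subn1.
rewrite [in LHS]mulrCA [in RHS]mulrCA; congr (_ * _).
rewrite mulrA; congr (_ * _).
  rewrite /bump; case: (leqP p k) => _ /=; first by rewrite mulr1.
  by rewrite mul1r add0n.
rewrite [RHS]big_mkcond; apply: eq_bigr => j _.
by rewrite lift_perm_lift ltnNge leq_bump2 -ltnNge.
Qed.

(** If [p < size xi], every position before [p] also carries a part, so all factors containing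
    [x ord0] are sums. Their product is symmetric in the other variables and leaves the sum over
    [v]. *)
Lemma alternantQ_recl (S : comNzRingType) (M : nat) (x : 'I_M.+1 -> S)
    (xi : seq nat) (y := fun k => x (lift ord0 k))
    (G := fun (i : nat) (a c : S) => if (i < size xi)%N then a + c else a - c) :
  alternantQ x xi =
  \sum_(p < M.+1) (-1) ^+ p *
    if (p < size xi)%N then
      x ord0 ^+ nth 0%N xi p * \prod_(k < M) (x ord0 + y k) *
      alternantQ y (omit p xi)
    else
      \sum_(v : 'S_M) (-1) ^+ v *
        (\prod_(k < M) (if (p <= k)%N then x ord0 - y (v k)
                        else G k (y (v k)) (x ord0)) *
         \prod_(k < M) (y (v k) ^+ nth 0%N xi (bump p k) *
           \prod_(j < M | (k < j)%N) G (bump p k) (y (v k)) (y (v j)))).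
Proof.
rewrite alternantQ_lift_perm; apply: eq_bigr => p _; congr (_ * _).
case: ltnP => [lt_p|le_p]; last first.
  by apply: eq_bigr => v _; rewrite (nth_default _ le_p) expr0 mul1r.
rewrite /alternantQ mulr_sumr; apply: eq_bigr => v _.
rewrite [RHS]mulrCA; congr (_ * (_ * _ * _)).
  rewrite [RHS](reindex_inj (@perm_inj _ v)); apply: eq_bigr => k _.
  by case: (leqP p k) => // lt_kp; rewrite (ltn_trans lt_kp lt_p) addrC.
apply: eq_bigr => k _; rewrite nth_omit //; congr (_ * _).
apply: eq_bigr => j _; rewrite size_omit //.
rewrite (_ : (bump p k < size xi)%N = (k < (size xi).-1)%N) //.
rewrite [RHS]ltn_predRL /bump; case: (leqP p k) => //= lt_kp.
by rewrite add0n (ltn_trans lt_kp lt_p) (leq_ltn_trans lt_kp lt_p).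
Qed.

(** * Coefficients with respect to the first variable *)

(** The first variable becomes the indeterminate of a polynomial ring over the others, so that its
    powers are separated by polynomial coefficients. *)
Definition cons_var (R : comNzRingType) (M : nat) (y : 'I_M -> R)
    (i : 'I_M.+1) : {poly R} :=
  oapp (fun k => (y k)%:P) 'X (unlift ord0 i).

Lemma cons_var0 (R : comNzRingType) (M : nat) (y : 'I_M -> R) :
  cons_var y ord0 = 'X.
Proof. by rewrite /cons_var unlift_none. Qed.

Lemma cons_var_lift (R : comNzRingType) (M : nat) (y : 'I_M -> R) (k : 'I_M) :
  cons_var y (lift ord0 k) = (y k)%:P.
Proof. by rewrite /cons_var liftK. Qed.

(* When [x ord0] stands in a position [p >= size xi], every other variable
   contributes one factor linear in it, so its degree is at most [M]. *)
Lemma coef_alternantQ (R : comNzRingType) (M : nat) (y : 'I_M -> R)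
    (xi : seq nat) (K : nat) : (M < K)%N ->
  (alternantQ (cons_var y) xi)`_K =
  \sum_(p < M.+1 | (p < size xi)%N) (-1) ^+ p *
    ('X^(nth 0%N xi p) * \prod_(k < M) ('X + (y k)%:P))`_K *
    alternantQ y (omit p xi).
Proof.
move=> lt_MK; rewrite alternantQ_recl coef_sum [RHS]big_mkcond.
apply: eq_bigr => p _; rewrite -signr_odd -(rmorph_sign (@polyC R)) coefCM.
case: ltnP => [lt_p|le_p].
  rewrite signr_odd -[RHS]mulrA; congr (_ * _); rewrite -coefMC; congr (_`_K).
  rewrite cons_var0 (eq_alternantQ _ (cons_var_lift y)).
  rewrite -(rmorph_alternantQ (@polyC R) y).
  by under eq_bigr do rewrite cons_var_lift.
rewrite coef_sum big1 ?mulr0 // => v _.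
rewrite -(rmorph_sign (@polyC R)) coefCM.
set A := \prod_(k < M) _; set B := \prod_(k < M) _.
have -> : B = (\prod_(k < M) (y (v k) ^+ nth 0%N xi (bump p k) *
    \prod_(j < M | (k < j)%N) if (bump p k < size xi)%N
      then y (v k) + y (v j) else y (v k) - y (v j)))%:P.
  rewrite rmorph_prod; apply: eq_bigr => k _.
  rewrite cons_var_lift rmorphM rmorphXn rmorph_prod.
  congr (_ * _); apply: eq_bigr => j _; rewrite cons_var_lift.
  by case: ifP => _; rewrite ?rmorphB ?rmorphD.
rewrite coefMC nth_default ?mul0r ?mulr0 //; apply: leq_trans lt_MK.
apply: leq_trans (size_poly_prod_leq _ _) _.
(* [M] factors of size at most 2 give a product of size at most [2 * M + 1 - M]. *)
rewrite card_ord leq_subLR addnS ltnS addnn -mul2n mulnC.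
rewrite -[X in (_ <= X * _)%N](card_ord M) -sum_nat_const leq_sum // => k _.
rewrite cons_var0 cons_var_lift.
case: ifP => _; first by rewrite size_XsubC.
case: ifP => _; first by rewrite addrC size_XaddC.
by rewrite -size_polyN opprB size_XsubC.
Qed.

(** * Strictly decreasing exponents and rigidity of permutations *)

Lemma perm_homo_ltn (N : nat) (s : 'S_N) :
  {homo s : i j / (i < j)%N} -> s = 1%g.
Proof.
(* An increasing permutation never lowers an index; applied to [s] and to its inverse, this gives
   equality. *)
have le_homo (t : 'S_N) : {homo t : i j / (i < j)%N} ->
      forall i : 'I_N, (i <= t i)%N.
  move=> t_homo [i lt_iN]; elim: i lt_iN => //= i IHi lt_iN.
  exact: leq_ltn_trans (IHi (ltnW lt_iN)) (t_homo (Ordinal (ltnW lt_iN)) _ _).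
move=> s_homo; have sV_homo : {homo (s^-1)%g : i j / (i < j)%N}.
  move=> i j lt_ij; rewrite ltnNge; apply/negP; rewrite leq_eqVlt.
  case/orP=> [/eqP/val_inj/perm_inj ij | /s_homo].
    by rewrite ij ltnn in lt_ij.
  by rewrite !permKV ltnNge ltnW.
apply/permP=> i; rewrite perm1; apply/val_inj/anti_leq.
rewrite (le_homo _ s_homo) andbT.
by have := le_homo _ sV_homo (s i); rewrite permK.
Qed.

(** For [i < j], [e (s j) <= a j < a i <= e (s i) + 1], hence [e (s j) <= e (s i)] and [s] is
    increasing. The slack of 1 accommodates vertical strips. *)
Lemma perm_decreasing (N : nat) (e a : 'I_N -> nat) (s : 'S_N) :
  {homo e : i j / (i < j)%N >-> (i > j)%N} ->
  {homo a : i j / (i < j)%N >-> (i > j)%N} ->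
  (forall i, (e (s i) <= a i <= (e (s i)).+1)%N) -> s = 1%g.
Proof.
move=> e_dec a_dec es_a; apply: perm_homo_ltn => i j lt_ij.
have /andP[_ ai] := es_a i; have /andP[aj _] := es_a j.
have le_e : (e (s j) <= e (s i))%N.
  by rewrite -ltnS; apply: leq_trans ai; apply: leq_ltn_trans aj (a_dec _ _ lt_ij).
rewrite ltnNge leq_eqVlt; apply/negP=> /orP[/eqP/val_inj/perm_inj ji|/e_dec].
  by rewrite ji ltnn in lt_ij.
by rewrite ltnNge le_e.
Qed.

Lemma nth_partition (la : seq nat) (i j : nat) : is_partition la ->
  (i <= j)%N -> (nth 0%N la j <= nth 0%N la i)%N.
Proof.
case/andP=> la_dec _ le_ij; case: (ltnP j (size la)) => [lt_j|le_j]; last first.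
  by rewrite [X in (X <= _)%N]nth_default.
have geq_trans : transitive geq by move=> x y z /= xy yz; apply: leq_trans yz xy.
by apply: (sorted_leq_nth geq_trans leqnn 0%N la_dec) => //; apply: leq_ltn_trans lt_j.
Qed.

(** Padding by zeros loses no information, since a partition has no zero part. *)
Lemma partition_eq (N : nat) (s t : seq nat) :
  is_partition s -> is_partition t -> (size s <= N)%N -> (size t <= N)%N ->
  (forall i : 'I_N, nth 0%N s i = nth 0%N t i) -> s = t.
Proof.
move=> s_part t_part sN tN st.
have E i : nth 0%N s i = nth 0%N t i.
  case: (ltnP i N) => [lt_i|le_i]; first exact: st (Ordinal lt_i).
  by rewrite !nth_default // (leq_trans _ le_i).
have le_size u v : is_partition u -> nth 0%N u =1 nth 0%N v ->
    (size u <= size v)%N.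
  case/andP=> _ u0 uv; rewrite leqNgt; apply: contra u0 => lt_vu.
  by have := mem_nth 0%N lt_vu; rewrite uv nth_default.
apply: (@eq_from_nth _ 0%N) => //.
by apply/anti_leq; rewrite !le_size // => i.
Qed.

(** The exponents [la + delta], with [delta = (N-1, ..., 1, 0)], of the diagonal term of the
    alternant. *)
Definition shifted (N : nat) (la : seq nat) (i : 'I_N) : nat :=
  nth 0%N la i + (N - i.+1).

Lemma shifted_decreasing (N : nat) (la : seq nat) : is_partition la ->
  {homo @shifted N la : i j / (i < j)%N >-> (i > j)%N}.
Proof.
move=> la_part i j lt_ij; rewrite /shifted -addnS leq_add //.
  exact: nth_partition (ltnW lt_ij).
by rewrite ltn_sub2l // (leq_ltn_trans lt_ij).
Qed.

Lemma sum_sign_perm1 (R : pzRingType) (N : nat) (c : bool) :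
  \sum_(s : 'S_N) (-1) ^+ s * ((s == 1%g) && c)%:R = c%:R :> R.
Proof.
rewrite (bigD1 1%g) //= odd_perm1 eqxx mul1r big1 ?addr0 // => s /negPf ->.
by rewrite mulr0.
Qed.

(** * Coefficients of alternants and the Pieri rule *)

Lemma alternant_mpolyX (M : nat) (la : seq nat) :
  alternant (fun k => 'X_k : {mpoly int[M]}) la =
  \sum_(s : 'S_M) (-1) ^+ s * 'X_[[multinom shifted la (s k) | k < M]].
Proof.
apply: eq_bigr => s _; congr (_ * _); rewrite mpolyXE_id.
by apply: eq_bigr => k _; rewrite mxE mnmE.
Qed.

(** Both exponent sequences decrease strictly, so only the identity permutation can match them.
    Reading this coefficient in a Schur expansion thus isolates one partition. *)
Lemma coef_alternant (M : nat) (la mu : seq nat) :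
  is_partition la -> is_partition mu ->
  (size la <= M.+1)%N -> (size mu <= M.+1)%N ->
  ((alternant (cons_var (fun k => 'X_k : {mpoly int[M]})) mu)
     `_(shifted la (ord0 : 'I_M.+1)))
     @_[multinom shifted la (lift ord0 k) | k < M] = (mu == la)%:R.
Proof.
move=> la_part mu_part la_M mu_M.
rewrite /alternant /determinant coef_sum raddf_sum -(sum_sign_perm1 _ M.+1).
apply: eq_bigr => s _ /=.
rewrite -(rmorph_sign (@polyC _)) coefCM -(rmorph_sign (@mpolyC M int)) mcoeffCM.
congr (_ * _); rewrite big_ord_recl mxE cons_var0.
have -> : \prod_(k < M) (\matrix_(i, j) cons_var (fun k => 'X_k : {mpoly int[M]}) i ^+
      (nth 0%N mu j + (M.+1 - j.+1))) (lift ord0 k) (s (lift ord0 k)) =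
    ('X_[[multinom shifted mu (s (lift ord0 k)) | k < M]])%:P.
  rewrite mpolyXE_id rmorph_prod; apply: eq_bigr => k _.
  by rewrite mxE cons_var_lift mnmE rmorphXn.
rewrite coefMC coefXn -(rmorph_nat (@mpolyC M int)) mcoeffCM mcoeffX -natrM mulnb.
congr (nat_of_bool _)%:R; apply/andP/andP => [[/eqP E0 /eqP EL]|[/eqP-> /eqP->]].
  have E i : shifted mu (s i) = shifted la i.
    case: (unliftP ord0 i) => [k|] ->; last by rewrite E0.
    by have := congr1 (fun m : 'X_{1..M} => m k) EL; rewrite /= !mnmE.
  have s1 : s = 1%g.
    apply: perm_decreasing (shifted_decreasing mu_part) (shifted_decreasing la_part) _.
    by move=> i; rewrite E leqnn leqnSn.
  rewrite s1; split=> //; apply/eqP; apply: partition_eq mu_M la_M _ => // i.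
  by move/eqP: (E i); rewrite s1 perm1 eqn_add2r => /eqP.
split; first by rewrite perm1.
by apply/eqP/mnmP=> k; rewrite !mnmE perm1.
Qed.

Lemma sum_nth (s : seq nat) (N : nat) : (size s <= N)%N ->
  (\sum_(i < N) nth 0 s i = sumn s)%N.
Proof.
move=> le_s; rewrite sumnE (big_nth 0%N) big_mkord (big_ord_widen _ _ le_s).
rewrite [RHS]big_mkcond; apply: eq_bigr => i _.
by case: ltnP => // le_si; rewrite nth_default.
Qed.

(** Here [f] marks the factors that contribute their own variable, the others contributing ['X]; the
    coefficient is the elementary symmetric polynomial of degree [k + M - K]. *)
Lemma coef_prodXaddX (M k K : nat) :
  ('X^k * \prod_(j < M) ('X + ('X_j : {mpoly int[M]})%:P))`_K =
  \sum_(f : {ffun 'I_M -> bool})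
    (K == k + \sum_(j < M) ~~ f j)%N%:R * 'X_[[multinom f j : nat | j < M]].
Proof.
pose F (j : 'I_M) (c : bool) := if c then ('X_j : {mpoly int[M]})%:P else 'X.
have -> : \prod_(j < M) ('X + ('X_j : {mpoly int[M]})%:P) =
    \prod_(j < M) \sum_(c : bool) F j c.
  by apply: eq_bigr => j _; rewrite big_bool addrC.
rewrite bigA_distr_bigA mulr_sumr coef_sum; apply: eq_bigr => f _.
have -> : \prod_(j < M) F j (f j) =
    'X^(\sum_(j < M) ~~ f j) * ('X_[[multinom f j : nat | j < M]])%:P.
  rewrite mpolyXE_id rmorph_prod -prodrXr -big_split; apply: eq_bigr => j _.
  rewrite mnmE /F /=; case: (f j) => /=; first by rewrite expr0 mul1r expr1.
  by rewrite expr0 polyC1 mulr1.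
by rewrite mulrA -exprD coefMC coefXn.
Qed.

(* The Pieri rule for elementary symmetric functions: in
   [m = (shifted rho \o s) + 1_A] both [m] and [shifted rho] decrease strictly,
   which forces [s = 1] and [A = mu / rho]. *)
Lemma coef_Pieri (M k K : nat) (mu rho : seq nat) :
  is_partition mu -> is_partition rho ->
  (size mu <= M)%N -> (size rho <= M)%N ->
  (sumn mu + K = k + M + sumn rho)%N ->
  (('X^k * \prod_(j < M) ('X + ('X_j : {mpoly int[M]})%:P))`_K *
     alternant (fun j => 'X_j) rho)@_[multinom shifted mu j | j < M] =
  [forall j : 'I_M, (nth 0%N rho j <= nth 0%N mu j <= (nth 0%N rho j).+1)%N]%:R.
Proof.
move=> mu_part rho_part mu_M rho_M Ksum.
rewrite coef_prodXaddX alternant_mpolyX mulr_suml raddf_sum /=.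
set strip := [forall j, _].
(* The only possible choice of variables: the rows in which [mu] exceeds [rho]. *)
pose f0 : {ffun 'I_M -> bool} := [ffun j : 'I_M => (nth 0 rho j < nth 0 mu j)%N].
have term (f : {ffun 'I_M -> bool}) (s : 'S_M) :
    (K == k + \sum_(j < M) ~~ f j)%N &&
    ([multinom f j : nat | j < M] + [multinom shifted rho (s j) | j < M] ==
     [multinom shifted mu j | j < M])%MM = (s == 1%g) && ((f == f0) && strip).
  apply/andP/and3P => [[_ /eqP /mnmP E]|[/eqP-> /eqP-> /forallP strip_j]].
    have {}E j : (f j + shifted rho (s j) = shifted mu j)%N.
      by have := E j; rewrite mnmDE !mnmE.
    have s1 : s = 1%g.
      apply: perm_decreasing (shifted_decreasing rho_part) (shifted_decreasing mu_part) _.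
      by move=> j; rewrite -E leq_addl -add1n leq_add2r leq_b1.
    have {}E (j : 'I_M) : nth 0%N mu j = (f j + nth 0 rho j)%N.
      by have := E j; rewrite s1 perm1 addnA => /eqP; rewrite eqn_add2r => /eqP.
    rewrite s1 eqxx; split=> //.
      apply/eqP/ffunP=> j; rewrite ffunE E.
      by case: (f j); rewrite ?add1n ?leqnn // add0n ltnn.
    by apply/forallP=> j; rewrite E leq_addl -add1n leq_add2r leq_b1.
  have E (j : 'I_M) : nth 0%N mu j = (f0 j + nth 0 rho j)%N.
    have /andP[le_j le_jS] := strip_j j; apply/anti_leq; rewrite ffunE.
    by case: ltnP => [lt_j|le_j']; rewrite ?add1n ?add0n ?le_jS ?le_j'.
  split; last by apply/eqP/mnmP=> j; rewrite mnmDE !mnmE perm1 /shifted E addnA.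
  (* The condition on [K] is a count: [f0] is true in [sumn mu - sumn rho] rows, and [Ksum] fixes
     the number of the others. *)
  have f0_sum : (\sum_(j < M) ~~ f0 j + \sum_(j < M) f0 j = M)%N.
    rewrite -big_split /= -[RHS]card_ord -sum1_card; apply: eq_bigr => j _.
    by case: (f0 j).
  move: Ksum; rewrite -(sum_nth mu_M) -(sum_nth rho_M) (eq_bigr _ (fun j _ => E j)).
  rewrite big_split /=; set r := (\sum_(j < M) nth 0 rho j)%N.
  rewrite -[in RHS]f0_sum -(eqn_add2l (\sum_(j < M) f0 j + r)) => ->.
  by rewrite addnA -addnA addnC.
rewrite (eq_bigr (fun f => ((f == f0) && strip)%:R)) => [|f _].
  by rewrite (bigD1 f0) //= eqxx big1 ?addr0 // => f /negPf ->.
rewrite mulr_sumr raddf_sum /=.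
rewrite (eq_bigr (fun s : 'S_M => (-1) ^+ s * ((s == 1%g) && ((f == f0) && strip))%:R)).
  exact: sum_sign_perm1.
move=> s _; rewrite -term mulrCA -(rmorph_sign (@mpolyC M int)) mcoeffCM; congr (_ * _).
by rewrite -mulrA -mpolyXD -(rmorph_nat (@mpolyC M int)) mcoeffCM mcoeffX -natrM mulnb.
Qed.

(** * Removing a part, and the contribution of each position *)

Lemma omit_strict (p : nat) (xi : seq nat) :
  is_strict_partition xi -> is_strict_partition (omit p xi).
Proof.
have sub : subseq (omit p xi) xi.
  by rewrite -[X in subseq _ X](cat_take_drop p) cat_subseq // -add1n -drop_drop drop_subseq.
case/andP=> xi_dec xi0; rewrite /is_strict_partition.
rewrite (subseq_sorted _ sub xi_dec) => [|i j k /= ji kj]; last exact: ltn_trans kj ji.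
by apply: contra xi0; apply: mem_subseq.
Qed.

Lemma sumn_omit (p : nat) (xi : seq nat) : (p < size xi)%N ->
  (sumn (omit p xi) + nth 0 xi p = sumn xi)%N.
Proof.
move=> lt_p; rewrite -[in RHS](cat_take_drop p xi) (drop_nth 0%N lt_p).
by rewrite !sumn_cat /= addnCA addnC addnA.
Qed.

(** Quantifying over [M] rows absorbs the length condition: a part of [rho] below the last row of
    [mu] would have to be 0. *)
Lemma vertical_stripE (M : nat) (mu rho : seq nat) (s : int) :
  is_partition mu -> is_partition rho -> (size mu <= M)%N -> (size rho <= M)%N ->
  (sumn mu)%:Z - (sumn rho)%:Z = s ->
  vertical_strip mu rho s =
  [forall j : 'I_M, (nth 0%N rho j <= nth 0%N mu j <= (nth 0%N rho j).+1)%N].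
Proof.
move=> mu_part rho_part mu_M rho_M s_eq.
rewrite /vertical_strip rho_part s_eq eqxx andbT /=.
apply/andP/forallP => [[le_size /forallP strip] j|strip].
  case: (ltnP j (size mu)) => [lt_j|le_j]; first exact: strip (Ordinal lt_j).
  by rewrite !nth_default // (leq_trans le_size).
split; last by apply/forallP=> j; apply: strip (widen_ord mu_M j).
rewrite leqNgt; apply/negP => lt_size; case/andP: rho_part => _ /negP[].
have := strip (Ordinal (leq_trans lt_size rho_M)).
by rewrite /= [nth 0%N mu _]nth_default // leqn0 => /andP[/eqP <- _]; rewrite mem_nth.
Qed.

Lemma mcoeff_natM (M k : nat) (P : {mpoly int[M]}) m : (k%:R * P)@_m = k%:R * P@_m.
Proof. by rewrite -(rmorph_nat (@mpolyC M int)) mcoeffCM. Qed.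

Lemma mcoeff_intM (M : nat) (k : int) (P : {mpoly int[M]}) m :
  (k%:~R * P)@_m = k * P@_m.
Proof. by rewrite -(rmorph_int (@mpolyC M int)) mcoeffCM intz. Qed.

(** The contribution of position [p]: the expansion of [alternantQ] for [omit p xi] in [M]
    variables, combined with the Pieri rule. *)
Lemma coef_Pieri_alternantQ (b : seq nat -> seq nat -> int)
    (b_coef : schurQ_coefficients b) (M a p : nat) (xi mu : seq nat) :
  is_strict_partition xi -> sumn xi = M.+1 -> (p < size xi)%N ->
  is_partition mu -> (size mu <= M)%N -> (a + sumn mu)%N = M.+1 ->
  (2 ^+ size xi * ((-1) ^+ p *
     ('X^(nth 0%N xi p) * \prod_(j < M) ('X + ('X_j : {mpoly int[M]})%:P))`_(a + M) *
     alternantQ (fun j => 'X_j) (omit p xi)))@_[multinom shifted mu j | j < M] =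
  ((M.+1 - size xi)`!)%:R * (2 * (-1) ^+ p *
    \sum_(rho <- partitions_upto M.+1 |
       vertical_strip mu rho ((nth 0%N xi p)%:Z - a%:Z)) b (omit p xi) rho).
Proof.
move=> xi_strict xi_M lt_p mu_part mu_M mu_sum.
have xi_gt0 : (0 < size xi)%N by apply: leq_ltn_trans lt_p.
(* The removed part is positive, so what remains has size at most [M] and its expansion is available
   in [M] variables. *)
have xip_gt0 : (0 < nth 0 xi p)%N.
  by have /andP[_ xi0] := xi_strict; rewrite lt0n; apply: contraNneq xi0 => <-; rewrite mem_nth.
have so := sumn_omit lt_p; set s := sumn (omit p xi) in so.
have s_M : (s <= M)%N by rewrite -ltnS -xi_M -so -addn1 leq_add2l.
have := alternantQ_expansion b_coef (fun j => 'X_j : {mpoly int[M]})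
  (omit_strict p xi_strict) s_M.
(* The number of variables and the length both drop by one, so the factorial is the same as for
   [xi]. *)
rewrite size_omit // (_ : M - (size xi).-1 = M.+1 - size xi)%N; last first.
  by rewrite -[in RHS](prednK xi_gt0) subSS.
set F := ((_)`!)%N; set A := nth _ _ (a + M); set m := [multinom _ | _ < M].
(* One of the [size xi] factors 2 splits off and becomes the 2 of the recursion. *)
move=> EQ; rewrite -(prednK xi_gt0) exprS mulrACA {}EQ.
rewrite mulrCA mcoeff_natM -!mulrA mcoeff_natM; congr (_ * (_ * _)).
rewrite -signr_odd -(rmorph_sign (@mpolyC M int)) mcoeffCM signr_odd; congr (_ * _).
have s_eq : (sumn mu)%:Z - s%:Z = (nth 0%N xi p)%:Z - a%:Z.
  apply/eqP; rewrite subr_eq addrAC eq_sym subr_eq -!PoszD eqz_nat.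
  by rewrite addnC so xi_M addnC mu_sum.
pose strip rho :=
  [forall j : 'I_M, (nth 0%N rho j <= nth 0%N mu j <= (nth 0%N rho j).+1)%N].
have stripE rho : is_partition rho -> sumn rho = s ->
    vertical_strip mu rho ((nth 0%N xi p)%:Z - a%:Z) = strip rho.
  move=> rho_part rho_s; apply: vertical_stripE => //; last by rewrite rho_s.
  by apply: leq_trans (size_partition rho_part) _; rewrite rho_s.
transitivity (\sum_(rho <- partitions_upto s | (sumn rho == s) && strip rho)
    b (omit p xi) rho).
  rewrite big_mkcondr mulr_sumr raddf_sum big_seq_cond [RHS]big_seq_cond /=.
  apply: eq_bigr => rho; rewrite mem_partitions_upto => /andP[/andP[rho_part _] /eqP rho_s].
  rewrite mulrCA mcoeff_intM coef_Pieri //.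
  - by rewrite -/(strip rho); case: (strip rho); rewrite ?mulr1 ?mulr0.
  - by apply: leq_trans (size_partition rho_part) _; rewrite rho_s.
  - by rewrite addnA [(sumn mu + a)%N]addnC mu_sum -xi_M -so rho_s -addnA addnC.
(* The two ranges select the same partitions: the prescribed strip size forces [sumn rho = s]. *)
rewrite -big_filter -[RHS]big_filter; apply: perm_big.
apply: uniq_perm => [||rho]; try exact: filter_uniq (uniq_partitions_upto _).
rewrite [in LHS]mem_filter [in RHS]mem_filter !mem_partitions_upto.
apply/idP/idP => [/andP[/andP[/eqP rho_s strip_rho] /andP[rho_part _]]|].
  by rewrite stripE // rho_part rho_s strip_rho leqW.
case/andP=> vs /andP[rho_part _].
have rho_s : sumn rho = s.
  by case/and4P: (vs) => _ _ _; rewrite -s_eq (inj_eq (addrI _)) eqr_opp eqz_nat => /eqP.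
by rewrite -stripE // vs rho_s eqxx rho_part leqnn.
Qed.

(* In the sum, i is numbered from 0, so the sign is (-1)^i.  The case n = 0 is
   excluded: there b [::] [::] = 1, while the sum is empty. *)
Theorem theorem4p3 (b : seq nat -> seq nat -> int)
    (b_coef : schurQ_coefficients b)
    (n : nat) (n_gt0 : (0 < n)%N)
    (xi : seq nat) (xi_strict : is_strict_partition xi) (xi_n : sumn xi = n)
    (la : seq nat) (la_part : is_partition la) (la_n : sumn la = n) :
  b xi la =
  \sum_(i < size xi) 2 * (-1) ^+ i *
    \sum_(rho <- partitions_upto n |
            vertical_strip (behead la) rho
              ((nth 0%N xi i)%:Z - (head 0%N la)%:Z))
      b (omit i xi) rho.
have xi_part := strict_partition xi_strict.
(* The number of variables is taken to be [n = M.+1], enough for every partition of [n]. *)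
case: n n_gt0 xi_n la_n => // M _ xi_n la_n.
have xi_M : (size xi <= M.+1)%N by rewrite -xi_n size_partition.
have la_M : (size la <= M.+1)%N by rewrite -la_n size_partition.
have xi_gt0 : (0 < size xi)%N by case: (xi) xi_n.
have la_gt0 : (0 < nth 0 la 0)%N.
  by case: (la) la_part la_n => // a s /andP[_]; rewrite inE negb_or eq_sym -lt0n => /andP[].
have sum_la : (nth 0 la 0 + sumn (behead la))%N = M.+1 by case: (la) la_n.
set mu := behead la in sum_la *; set K := shifted la (ord0 : 'I_M.+1).
have mu_part : is_partition mu.
  case/andP: la_part => la_dec la0; rewrite /is_partition /mu.
  case: (la) la_dec la0 => // a s /path_sorted /= -> /=.
  by rewrite inE negb_or => /andP[].
have mu_M : (size mu <= M)%N by rewrite size_behead -ltnS prednK //; case: (la) la_gt0.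
have K_eq : K = (nth 0 la 0 + M)%N by rewrite /K /shifted /= subn1.
pose m := [multinom shifted mu j | j < M].
(* Dropping the first row and one variable leaves the other exponents of [la + delta] unchanged. *)
have m_eq : m = [multinom shifted la (lift ord0 j) | j < M].
  by apply/mnmP=> j; rewrite !mnmE /shifted nth_behead.
pose x := cons_var (fun k => 'X_k : {mpoly int[M]}).
(* [c] reads the coefficient of the monomial with exponents [la + delta]; it is applied to both
   sides of the expansion of [alternantQ x xi]. *)
pose c (P : {poly {mpoly int[M]}}) : int := (P`_K)@_m.
have c_nat k P : c (k%:R * P) = k%:R * c P.
  by rewrite /c -(rmorph_nat (@polyC _)) coefCM mcoeff_natM.
have c_int k P : c (k%:~R * P) = k * c P.
  by rewrite /c -(rmorph_int (@polyC _)) coefCM mcoeff_intM.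
set F := ((M.+1 - size xi)`!)%N.
have := alternantQ_expansion b_coef x xi_strict.
rewrite xi_n leqnn -/F => /(_ isT) /(congr1 c).
have -> : c (F%:R * \sum_(nu <- partitions_upto M.+1 | sumn nu == M.+1)
    (b xi nu)%:~R * alternant x nu) = F%:R * b xi la.
  rewrite c_nat /c coef_sum raddf_sum /=; congr (_ * _).
  rewrite big_mkcond (bigD1_seq la) ?uniq_partitions_upto //=; last first.
    by rewrite mem_partitions_upto la_part la_n leqnn.
  have c_term nu : is_partition nu -> sumn nu = M.+1 ->
      c ((b xi nu)%:~R * alternant x nu) = b xi nu * (nu == la)%:R.
    move=> nu_part nu_n; rewrite c_int /c m_eq coef_alternant //.
    by rewrite -nu_n size_partition.
  rewrite la_n eqxx -/(c _) c_term // eqxx mulr1 big1_seq ?addr0 // => nu.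
  case/andP=> nu_la; rewrite mem_partitions_upto => /andP[nu_part _].
  by case: eqP => // nu_n; rewrite -/(c _) c_term // (negPf nu_la) mulr0.
have -> : c (2 ^+ size xi * alternantQ x xi) = F%:R * \sum_(p < size xi) 2 * (-1) ^+ p *
    \sum_(rho <- partitions_upto M.+1 |
       vertical_strip mu rho ((nth 0%N xi p)%:Z - (head 0%N la)%:Z)) b (omit p xi) rho.
  (* The condition [M < K] holds because [K] is [M] plus the positive first part of [la]. *)
  rewrite -natrX c_nat /c coef_alternantQ; last by rewrite K_eq -addn1 addnC leq_add2r.
  rewrite -mcoeff_natM natrX mulr_sumr raddf_sum mulr_sumr.
  rewrite (big_ord_widen_cond _ xpredT (fun p => F%:R * (2 * (-1) ^+ p *
    \sum_(rho <- partitions_upto M.+1 | vertical_strip mu rho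
      ((nth 0%N xi p)%:Z - (head 0%N la)%:Z)) b (omit p xi) rho)) xi_M).
  apply: eq_bigr => p lt_p; rewrite K_eq -nth0 /=.
  exact: coef_Pieri_alternantQ.
(* The common factor [F%:R] is a nonzero integer and cancels. *)
by move/mulfI => <- //; rewrite Num.Theory.pnatr_eq0 -lt0n fact_gt0.
Qed.
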